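(* Let $\mathcal{A}$ be a finite or countable alphabet, $\mathcal{M}$ a countable set of probability measures on $\mathcal{A}^\infty$, $w:\mathcal{M}\to(0,1]$ a prior with $\sum_\nu w_\nu=1$, $\xi$ the Bayes mixture, $\mu\in\mathcal{M}$ and $\delta\in(0,1)$, with $\hat d_t:=c_t/(w_\mu\delta)$. Then: (1) $\mathbb{E}_\mu\sum_{t=1}^\infty\hat d_t\le\frac{\mathrm{Ent}(w)}{\delta w_\mu^2}$; (2) with $\mu$-probability at least $1-\delta$, $\sum_{t=1}^\infty\hat d_t\le\frac{\mathrm{Ent}(w)}{\delta^2w_\mu^2}$.
   Context: $\mathcal{A}^\infty$ carries the $\sigma$-algebra generated by cylinders $\Gamma_x=\{x\omega\}$; for a measure $\rho$, $\rho(x):=\rho(\Gamma_x)$, $\rho(y|x):=\rho(xy)/\rho(x)$. Bayes mixture $\xi(A):=\sum_\nu w_\nu\nu(A)$; posterior $w_\nu(x):=w_\nu\nu(x)/\xi(x)$; entropy $\mathrm{Ent}(w):=-\sum_\nu w_\nu\ln w_\nu$ (natural logs). For a finite string $x$, $d_x(\nu,\xi):=\sum_a\nu(a|x)\ln\frac{\nu(a|x)}{\xi(a|x)}$, and for $\omega\in\mathcal{A}^\infty$, $c_t(\omega):=\sum_{\nu\in\mathcal{M}}w_\nu(\omega_{<t})d_{\omega_{<t}}(\nu,\xi)$ with $\omega_{<t}=\omega_1\cdots\omega_{t-1}$. *)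

(* Defs.v *)
From HB Require Import structures.
From mathcomp Require Import all_boot all_order all_algebra.
From mathcomp Require Import all_classical all_reals all_analysis.
Set Implicit Arguments. Unset Strict Implicit. Unset Printing Implicit Defensive.
Import Order.TTheory GRing.Theory Num.Theory.
Local Open Scope classical_set_scope.
Local Open Scope ring_scope.

Section Defs.
Variable A : pointedType.

Definition cyl (x : seq A) : set (nat -> A) := [set om | mkseq om (size x) = x].

Definition seqspace := g_sigma_algebraType (range cyl).

(* omega_{<t} = omega_1 ... omega_{t-1} (with 0-based indexing: first t-1 symbols) *)
Definition prefix (om : nat -> A) (t : nat) : seq A := mkseq om t.-1.

Variable R : realType.

Definition pr (P : probability seqspace R) (x : seq A) : R := fine (P (cyl x)).

Variable I : choiceType.
Variables (nu : I -> probability seqspace R) (w : I -> R).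

Definition xsum {J : choiceType} (f : J -> \bar R) : \bar R :=
  (\esum_(j in [set: J]) maxe (f j) 0%E - \esum_(j in [set: J]) maxe (- f j) 0%E)%E.

Definition xi (x : seq A) : R := fine (\esum_(i in [set: I]) (w i * pr (nu i) x)%:E)%E.

Definition nu_cond (i : I) (x : seq A) (a : A) : R := pr (nu i) (rcons x a) / pr (nu i) x.
Definition xi_cond (x : seq A) (a : A) : R := xi (rcons x a) / xi x.

Definition post (i : I) (x : seq A) : R := w i * pr (nu i) x / xi x.

Definition dKL (i : I) (x : seq A) : \bar R :=
  xsum (fun a : A => (nu_cond i x a * ln (nu_cond i x a / xi_cond x a))%:E).

Definition ct (t : nat) (om : nat -> A) : \bar R :=
  xsum (fun i : I => ((post i (prefix om t))%:E * dKL i (prefix om t))%E).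

Definition Ent : \bar R := xsum (fun i : I => (- (w i * ln (w i)))%:E).

End Defs.

(* Main.v *)
Require Import Defs.
From HB Require Import structures.
From mathcomp Require Import all_boot all_order all_algebra ring lra.
From mathcomp Require Import all_classical all_reals all_analysis.
From mathcomp Require Import measurable_realfun.
Import Order.TTheory GRing.Theory Num.Theory.
Set Implicit Arguments. Unset Strict Implicit. Unset Printing Implicit Defensive.
Local Open Scope classical_set_scope.
Local Open Scope ring_scope.

(* By Bayes' rule the posterior weight of nu_i after the word xa is
     w_i(xa) = w_i(x) * nu_i(a|x) / xi(a|x),
   so taking nu_i(.|x)-averages of the logarithms gives the chain rule
     d_x(nu_i, xi) + sum_a nu_i(a|x) (- ln w_i(xa)) = - ln w_i(x).
   Hence the nu_i-expectations of the one-step divergences of nu_i from xi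
   telescope, and sum up to at most - ln w_i. The w-average of these
   expectations is the xi-expectation of c_t, so the xi-expectation of
   sum_t c_t is at most Ent(w), and w_mu mu <= xi transfers the bound to mu at
   the price of a factor 1 / w_mu. The second claim is Markov's inequality. *)

Section esum.
Local Open Scope ereal_scope.
Context {R : realType}.

Lemma esumZl (T : choiceType) (S : set T) (c : R) (a : T -> \bar R) :
  (0 <= c)%R -> (forall x, 0 <= a x) ->
  \esum_(x in S) (c%:E * a x) = c%:E * \esum_(x in S) a x.
Proof.
move=> c0 a0; rewrite /esum -ereal_supZl//; last first.
  by apply/set0P; exists 0, set0; [exact: fsets_set0|rewrite fsbig_set0].
congr ereal_sup; rewrite image_comp; apply: eq_imagel => X _ /=.
by rewrite ge0_mule_fsumr.
Qed.

Lemma esum_normalized (T : choiceType) (S : set T) (a : T -> R) (s : R) :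
  (forall x, 0 <= a x)%R -> (0 < s)%R -> \esum_(x in S) (a x)%:E = s%:E ->
  \esum_(x in S) (a x / s)%:E = 1.
Proof.
move=> a0 s_gt0 sum_a; under eq_esum do rewrite mulrC EFinM.
rewrite esumZl ?invr_ge0 ?(ltW s_gt0)//.
by rewrite sum_a -EFinM mulVf ?gt_eqF.
Qed.

Lemma exchange_esum (T1 T2 : choiceType) (S1 : set T1) (S2 : set T2)
    (a : T1 -> T2 -> \bar R) : (forall x y, 0 <= a x y) ->
  \esum_(x in S1) \esum_(y in S2) a x y = \esum_(y in S2) \esum_(x in S1) a x y.
Proof.
move=> a0; rewrite !esum_esum//.
rewrite (reindex_esum (S2 `*`` (fun=> S1)) _ (fun z => (z.2, z.1)))//.
split => [z []//|[x y] [x' y'] _ _ /= [-> ->]//|[x y] [/= Sx Sy]].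
by exists (y, x).
Qed.

Lemma esum_singleton (T : choiceType) (S : set T) (x : T) (a : T -> \bar R) :
  S x -> 0 <= a x -> (forall y, S y -> y <> x -> a y = 0) ->
  \esum_(y in S) a y = a x.
Proof.
move=> Sx ax0 a0; rewrite (esumID [set x]).
  rewrite [X in _ + X]esum1; last by move=> y [Sy yx]; exact: a0.
  by rewrite adde0 setI1 mem_set// esum_set1.
by move=> y Sy; have [->//|/eqP yx] := eqVneq y x; rewrite a0.
Qed.

Lemma le_esum_term (T : choiceType) (S : set T) (a : T -> \bar R) (x : T) :
  S x -> a x <= \esum_(y in S) a y.
Proof.
move=> Sx; apply: esum_ge; exists [set x]; last by rewrite fsbig_set1.
by split=> // _ ->.
Qed.

Lemma countable_esum_nneseries (T : choiceType) (S : set T) :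
  countable S ->
  exists2 e : nat -> option T, forall n x, e n = Some x -> S x &
    forall a : T -> \bar R, (forall x, S x -> 0 <= a x) ->
      \esum_(x in S) a x = \sum_(n <oo) oapp a 0 (e n).
Proof.
move=> /countable_injP[f finj].
pose e n := if pselect (exists2 x, S x & f x = n) is left h
            then Some (s2val (cid2 h)) else None.
have eS n x : e n = Some x -> S x.
  by rewrite /e; case: pselect => // h [<-]; case: cid2.
have ef x : S x -> e (f x) = Some x.
  move=> Sx; rewrite /e; case: pselect => [h|[]]; last by exists x.
  by congr Some; case: cid2 => y Sy /= fyx; apply: finj; rewrite ?inE.
exists e => // a a0.
have ae0 n : 0 <= oapp a 0 (e n).
  by case en: (e n) => [x|//]; exact/a0/eS/en.
rewrite nneseries_esumT// [RHS](esumID (f @` S))// setTI.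
rewrite [X in _ + X]esum1 ?adde0; last first.
  by move=> n [_ nfS]; rewrite /e; case: pselect.
by rewrite esum_image//; apply: eq_esum => x Sx; rewrite ef.
Qed.

Lemma ge0_xsumE (J : choiceType) (f : J -> \bar R) :
  (forall j, 0 <= f j) -> xsum f = \esum_(j in [set: J]) f j.
Proof.
move=> f0; rewrite /xsum [X in _ - X]esum1 ?sube0.
  by apply: eq_esum => j _; apply/max_idPl.
by move=> j _; apply/max_idPr; rewrite leeNl oppe0.
Qed.

Lemma xsumB (J : choiceType) (f g : J -> \bar R) :
  (forall j, 0 <= f j) -> (forall j, 0 <= g j) ->
  \esum_(j in [set: J]) f j < +oo -> \esum_(j in [set: J]) g j < +oo ->
  xsum (f \- g) = \esum_(j in [set: J]) f j - \esum_(j in [set: J]) g j.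
Proof.
move=> f0 g0 fy gy.
have summable_ge0 h : (forall j : J, 0 <= h j) ->
    \esum_(j in [set: J]) h j < +oo -> summable setT h.
  by move=> h0; rewrite /summable (eq_esum (b := h))// => j _; rewrite gee0_abs.
rewrite -esumB//; [|exact: summable_ge0..].
by congr (_ - _); apply: eq_esum => j _; rewrite ?funeposE ?funenegE.
Qed.

End esum.

Lemma countable_seq (T : Type) : countable [set: T] -> countable [set: seq T].
Proof. by move=> /Pcountable[T' ->]; exact: countableP. Qed.

Section integral_countable.
Local Open Scope ereal_scope.
Context d (T : measurableType d) (R : realType).
Variables (D : set T) (J : choiceType).
Hypothesis mD : measurable D.

Section esum_of_functions.
Variables (S : set J) (f : J -> T -> \bar R).
Hypothesis countable_S : countable S.
Hypothesis mf : forall j, S j -> measurable_fun D (f j).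
Hypothesis f_ge0 : forall j x, S j -> D x -> 0 <= f j x.

Lemma ge0_integral_esum (mu : {measure set T -> \bar R}) :
  \int[mu]_(x in D) (\esum_(j in S) f j x) =
  \esum_(j in S) \int[mu]_(x in D) f j x.
Proof.
have [e eS esumE] := countable_esum_nneseries (R := R) countable_S.
pose g n x := oapp (f ^~ x) 0 (e n).
have g_ge0 n x : D x -> 0 <= g n x.
  by rewrite /g; case en: (e n) => [j|//] /=; apply: f_ge0; exact: eS en.
have mg n : measurable_fun D (g n).
  by rewrite /g; case en: (e n) => [j|//] /=; exact/mf/eS/en.
under eq_integral => x /set_mem Dx.
  rewrite esumE; last by move=> j Sj; exact: f_ge0.
  over.
rewrite esumE; last by move=> j Sj; apply: integral_ge0 => x; exact: f_ge0.
rewrite integral_nneseries//; apply: eq_eseriesr => n _; rewrite /g.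
by case: (e n) => //=; rewrite integral0.
Qed.

End esum_of_functions.

Variable X : T -> J.

Lemma measurable_fun_countable_valued d' (T' : measurableType d')
    (F : J -> T') :
  countable [set: J] -> (forall j, measurable (D `&` X @^-1` [set j])) ->
  measurable_fun D (fun x => F (X x)).
Proof.
move=> cJ mX _ B mB.
rewrite (_ : _ `&` _ = \bigcup_j
    (if F j \in B then D `&` X @^-1` [set j] else set0)).
  by apply: countable_bigcupT_measurable => // j; case: ifP.
apply/seteqP; split => [x [Dx FXx]|x [j _]].
  by exists (X x) => //; rewrite mem_set.
by case: ifPn => // /set_mem FjB [Dx /= Xxj]; rewrite /preimage/= Xxj.
Qed.

Lemma ge0_integral_countable_valued (mu : {measure set T -> \bar R})
    (S : set J) (F : J -> \bar R) :
  countable S -> (forall j, S j -> measurable (D `&` X @^-1` [set j])) ->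
  (forall x, D x -> S (X x)) -> (forall j, 0 <= F j) ->
  \int[mu]_(x in D) F (X x) = \esum_(j in S) F j * mu (D `&` X @^-1` [set j]).
Proof.
move=> cS mX DS F_ge0.
pose E j := D `&` X @^-1` [set j].
have mE j : S j -> measurable_fun D (fun x => (\1_(E j) x : R)%:E).
  by move=> Sj; apply/measurable_EFinP/measurable_indic/mX.
transitivity (\int[mu]_(x in D) \esum_(j in S) F j * (\1_(E j) x : R)%:E).
  apply: eq_integral => x /set_mem Dx; rewrite (@esum_singleton _ _ _ (X x)).
  - by rewrite indicE mem_set ?mule1.
  - exact: DS.
  - by rewrite mule_ge0// lee_fin.
  - by move=> j _ jX; rewrite indicE memNset ?mule0// => -[_ /= /esym].
rewrite ge0_integral_esum//.
- apply: eq_esum => j Sj; rewrite ge0_integralZl//; last exact: mE.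
  by rewrite integral_indic//; [rewrite setIAC setIid|exact: mX].
- by move=> j Sj; apply: measurable_funeM; exact: mE.
- by move=> j x _ _; rewrite mule_ge0// lee_fin.
Qed.

End integral_countable.

Section markov.
Local Open Scope ereal_scope.
Context d (T : measurableType d) (R : realType).

Lemma ge0_integral0_gt0 (mu : {measure set T -> \bar R}) (f : T -> \bar R) :
  measurable_fun setT f -> (forall x, 0 <= f x) ->
  \int[mu]_x f x = 0 -> mu [set x | 0 < f x] = 0.
Proof.
move=> mf f0 intf0; apply: measure_negligible.
  by rewrite -[X in measurable X]setTI; exact: emeasurable_fun_o_infty.
have /(ae_eq_integral_abs mu measurableT mf) : \int[mu]_x `|f x| = 0.
  by under eq_integral do rewrite gee0_abs//.
by apply: negligibleS => x /= /[swap] /(_ I) ->; rewrite ltxx.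
Qed.

Lemma markov_gt (mu : {measure set T -> \bar R}) (f : T -> \bar R)
    (K : \bar R) (delta : R) :
  measurable_fun setT f -> (forall x, 0 <= f x) -> (0 < delta)%R ->
  \int[mu]_x f x <= K -> mu [set x | K * delta^-1%:E < f x] <= delta%:E.
Proof.
move=> mf f0 delta_gt0 fK.
have : 0 <= K by apply: le_trans fK; exact: integral_ge0.
case: K fK => [r fK|_ _|//]; last first.
  rewrite gt0_mulye ?lte_fin ?invr_gt0// (_ : [set x | _] = set0).
    by rewrite measure0 lee_fin ltW.
  by apply/seteqP; split => x //=; rewrite ltNge leey.
rewrite lee_fin le_eqVlt => /predU1P[r0|r_gt0].
  subst r; under eq_set do rewrite mul0e.
  rewrite ge0_integral0_gt0 ?lee_fin 1?ltW//.
  by apply/eqP; rewrite eq_le fK integral_ge0.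
have a_gt0 : (0 < r / delta)%R by rewrite divr_gt0.
have mU a : measurable [set x | a%:E <= `|f x|].
  rewrite -[X in measurable X]setTI; apply: emeasurable_fun_c_infty => //.
  exact: measurableT_comp.
apply: (@le_trans _ _ (mu [set x | (r / delta)%:E <= `|f x|])).
  apply: le_measure; rewrite ?inE//.
    by rewrite -[X in measurable X]setTI; exact: emeasurable_fun_o_infty.
  by move=> x /=; rewrite gee0_abs// => /ltW.
have := le_integral_abse mu measurableT mf a_gt0; rewrite setTI.
under eq_integral do rewrite gee0_abs//.
move=> /le_trans/(_ fK); rewrite -lee_pdivlMl// -EFinM invf_div.
by rewrite divfK ?gt_eqF.
Qed.

Lemma markov_probability_le (P : probability T R) (f : T -> \bar R)
    (K : \bar R) (delta : R) :
  measurable_fun setT f -> (forall x, 0 <= f x) -> (0 < delta)%R ->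
  \int[P]_x f x <= K -> (1 - delta)%:E <= P [set x | f x <= K * delta^-1%:E].
Proof.
move=> mf f0 delta_gt0 fK.
rewrite (_ : [set x | _] = ~` [set x | K * delta^-1%:E < f x]); last first.
  by apply/seteqP; split => x /=; rewrite leNgt => /negP.
rewrite probability_setC ?EFinB ?leeB//; first exact: markov_gt.
by rewrite -[X in measurable X]setTI; exact: emeasurable_fun_o_infty.
Qed.

End markov.

Lemma sub_le_mul_ln_div (R : realType) (p q : R) :
  0 <= p -> 0 <= q -> (q = 0 -> p = 0) -> p - q <= p * ln (p / q).
Proof.
rewrite le_eqVlt => /predU1P[<- q0 _|p_gt0 q0 qp]; first by rewrite mul0r; lra.
have q_gt0 : 0 < q.
  by rewrite lt0r q0 andbT; apply/eqP => /qp p0; rewrite p0 ltxx in p_gt0.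
have : ln (1 + (q / p - 1)) <= q / p - 1.
  by apply: le_ln1Dx; have := divr_gt0 q_gt0 p_gt0; lra.
rewrite subrKC -(invf_div p) lnV ?posrE ?divr_gt0// -(ler_pM2l p_gt0).
have -> : p * ((p / q)^-1 - 1) = q - p by field; rewrite !gt_eqF.
lra.
Qed.

Section relative_entropy.
Context {R : realType} {J : choiceType}.
Implicit Types p q : J -> R.

Definition relative_entropy p q : \bar R :=
  xsum (fun j => (p j * ln (p j / q j))%:E).

Lemma relative_entropy0 q : relative_entropy (fun=> 0) q = 0%E.
Proof.
by rewrite /relative_entropy ge0_xsumE ?esum1// => j *; rewrite mul0r.
Qed.

Definition mixture_component (c : R) p q : Prop :=
  [/\ 0 < c, forall j, 0 <= p j, (\esum_(j in [set: J]) (p j)%:E = 1)%E,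
      (\esum_(j in [set: J]) (q j)%:E <= 1)%E & forall j, c * p j <= q j].

Variables (c : R) (p q : J -> R).
Hypothesis component : mixture_component c p q.

Let c_gt0 : 0 < c. Proof. by case: component. Qed.

Let c_ge0 : 0 <= c. Proof. exact: ltW. Qed.

Let p_ge0 j : 0 <= p j. Proof. by case: component. Qed.

Let le_cpq j : c * p j <= q j. Proof. by case: component. Qed.

Let sum_p : (\esum_(j in [set: J]) (p j)%:E = 1)%E.
Proof. by case: component. Qed.

Let sum_q : (\esum_(j in [set: J]) (q j)%:E <= 1)%E.
Proof. by case: component. Qed.

Let q_ge0 j : 0 <= q j.
Proof. by apply: le_trans (le_cpq j); rewrite mulr_ge0. Qed.

Let p_eq0 j : q j = 0 -> p j = 0.
Proof.
move=> q0; apply/eqP; rewrite eq_le p_ge0 andbT.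
by rewrite -(pmulr_rle0 _ c_gt0) -q0.
Qed.

Lemma mixture_component_weight_le1 : c <= 1.
Proof.
rewrite -lee_fin (le_trans _ sum_q)// -[c%:E]mule1 -sum_p -esumZl//.
by apply: le_esum => j _; rewrite -EFinM lee_fin.
Qed.

(* [c * (p j / q j)] is the weight of [p] after a Bayesian update on [j]. *)
Let loss j := p j * - ln (c * (p j / q j)).

Let lossE j : loss j = - ln c * p j - p j * ln (p j / q j).
Proof.
rewrite /loss; have [->|pN0] := eqVneq (p j) 0.
  by rewrite mulr0 !mul0r subr0.
have qN0 : q j != 0 by apply: contraNneq pN0 => /p_eq0->.
rewrite lnM ?posrE//; first ring.
by rewrite divr_gt0 ?lt0r ?pN0 ?qN0/=.
Qed.

Let loss_ge0 j : 0 <= loss j.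
Proof.
rewrite /loss mulr_ge0// oppr_ge0 ln_le0// mulrA.
have [->|qN0] := eqVneq (q j) 0; first by rewrite invr0 mulr0.
by rewrite ler_pdivrMr ?mul1r// lt0r qN0 q_ge0.
Qed.

Let Nln_ge0 : 0 <= - ln c.
Proof. by rewrite oppr_ge0 ln_le0// mixture_component_weight_le1. Qed.

Let sum_lnp : (\esum_(j in [set: J]) (- ln c * p j)%:E = (- ln c)%:E)%E.
Proof.
under eq_esum do rewrite EFinM.
by rewrite esumZl ?sum_p ?mule1// => j; rewrite lee_fin.
Qed.

Let sum_loss_le : (\esum_(j in [set: J]) (loss j)%:E <= (- ln c)%:E)%E.
Proof.
rewrite -(@leeD2rE _ 1%E)// (le_trans _ (leeD2l _ sum_q))//.
rewrite -sum_p -sum_lnp -!esumD; try by move=> j _; rewrite lee_fin // mulr_ge0.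
apply: le_esum => j _; rewrite -!EFinD lee_fin lossE.
by have := sub_le_mul_ln_div (p_ge0 j) (q_ge0 j) (@p_eq0 j); lra.
Qed.

Let relative_entropyB :
  (relative_entropy p q = (- ln c)%:E - \esum_(j in [set: J]) (loss j)%:E)%E.
Proof.
rewrite -sum_lnp -xsumB; first last.
- by rewrite (le_lt_trans sum_loss_le)// ltry.
- by rewrite sum_lnp ltry.
- by move=> j; rewrite lee_fin.
- by move=> j; rewrite lee_fin mulr_ge0.
by congr (xsum _); apply/funext => j; rewrite -EFinB lossE; congr EFin; ring.
Qed.

Lemma relative_entropy_ge0 : (0 <= relative_entropy p q)%E.
Proof. by rewrite relative_entropyB sube_ge0 ?orbT. Qed.

Lemma relative_entropyD :
  (relative_entropy p q +
   \esum_(j in [set: J]) (p j * - ln (c * (p j / q j)))%:E = (- ln c)%:E)%E.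
Proof.
rewrite relative_entropyB subeK// ge0_fin_numE.
  by rewrite (le_lt_trans sum_loss_le)// ltry.
by apply: esum_ge0 => j _; rewrite lee_fin.
Qed.

End relative_entropy.

Section words.
Variables (A : pointedType) (R : realType).

Definition words (n : nat) : set (seq A) := [set x | size x = n].

Lemma measurable_cyl (x : seq A) : measurable (cyl x : set (seqspace A)).
Proof. by apply: sub_sigma_algebra; exists x. Qed.

Lemma cyl_rcons (x : seq A) (a : A) :
  cyl (rcons x a) = cyl x `&` (fun om => om (size x)) @^-1` [set a].
Proof.
apply/seteqP; split => om; rewrite /cyl /= size_rcons mkseqS.
  by move=> /rcons_inj[].
by move=> [-> ->].
Qed.

Lemma preimage_mkseq n (x : seq A) :
  (fun om : nat -> A => mkseq om n) @^-1` [set x] =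
  if size x == n then cyl x else set0.
Proof.
case: eqP => [<-//|xn]; apply/seteqP; split => // om /= omx.
by apply: xn; rewrite -omx size_mkseq.
Qed.

Lemma pr_ge0 (P : probability (seqspace A) R) x : 0 <= pr P x.
Proof. exact/fine_ge0/measure_ge0. Qed.

Lemma EFin_pr (P : probability (seqspace A) R) x : (pr P x)%:E = P (cyl x).
Proof. by rewrite /pr fineK// fin_num_measure//; exact: measurable_cyl. Qed.

Lemma pr_le1 (P : probability (seqspace A) R) x : pr P x <= 1.
Proof.
by rewrite -lee_fin EFin_pr probability_le1//; exact: measurable_cyl.
Qed.

Lemma pr_nil (P : probability (seqspace A) R) : pr P [::] = 1.
Proof.
apply: EFin_inj; rewrite EFin_pr -(probability_setT P); congr (P _).
by apply/seteqP; split.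
Qed.

Local Open Scope ereal_scope.

Hypothesis countable_A : countable [set: A].

Lemma measurable_fun_prefix d (T : measurableType d) n (F : seq A -> T) :
  measurable_fun [set: seqspace A] (fun om => F (mkseq om n)).
Proof.
apply: measurable_fun_countable_valued => // [|x].
  exact: countable_seq.
by rewrite setTI preimage_mkseq; case: ifP => // _; exact: measurable_cyl.
Qed.

Lemma integral_prefix (P : probability (seqspace A) R) n (F : seq A -> \bar R) :
  (forall x, 0 <= F x) ->
  \int[P]_om F (mkseq om n) = \esum_(x in words n) (pr P x)%:E * F x.
Proof.
move=> F_ge0.
rewrite (ge0_integral_countable_valued measurableT _ (S := words n))//.
- apply: eq_esum => x xn; rewrite setTI preimage_mkseq xn eqxx.
  by rewrite EFin_pr muleC.
- apply: sub_countable (countable_seq countable_A).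
  exact/subset_card_le/subsetT.
- by move=> x xn; rewrite setTI preimage_mkseq xn eqxx; exact: measurable_cyl.
- by move=> om _; rewrite /words/= size_mkseq.
Qed.

Lemma integral_prefixS (P : probability (seqspace A) R) n
    (F : seq A -> \bar R) :
  (forall x, 0 <= F x) ->
  \int[P]_om F (mkseq om n.+1) =
  \esum_(x in words n) \esum_(a in [set: A])
    (pr P (rcons x a))%:E * F (rcons x a).
Proof.
move=> F_ge0; rewrite integral_prefix// esum_esum; last first.
  by move=> x a _ _; rewrite mule_ge0// lee_fin pr_ge0.
rewrite (reindex_esum (words n `*`` (fun=> [set: A])) _
  (fun z => rcons z.1 z.2))//.
split.
- by move=> [x a] [/= xn _]; rewrite /words /= size_rcons xn.
- by move=> [x a] [y b] _ _ /= /rcons_inj[-> ->].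
- move=> x; case/lastP: x => [//|x a]; rewrite /words /= size_rcons => -[xn].
  by exists (x, a).
Qed.

Lemma esum_pr_rcons (P : probability (seqspace A) R) x :
  \esum_(a in [set: A]) (pr P (rcons x a))%:E = (pr P x)%:E.
Proof.
have mcyl := @measurable_cyl x.
rewrite EFin_pr -[RHS]mul1e -integral_cst//.
rewrite (ge0_integral_countable_valued (X := fun om => om (size x))
  mcyl P (F := cst 1) countable_A)//.
  by apply: eq_esum => a _; rewrite mul1e -cyl_rcons EFin_pr.
by move=> a _; rewrite -cyl_rcons; exact: measurable_cyl.
Qed.

Lemma pr_rcons_le (P : probability (seqspace A) R) x a :
  (pr P (rcons x a) <= pr P x)%R.
Proof.
rewrite -lee_fin !EFin_pr cyl_rcons; apply: le_measure => //; rewrite ?inE.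
  by rewrite -cyl_rcons; exact: measurable_cyl.
exact: measurable_cyl.
Qed.

End words.

Section mixture.
Variables (R : realType) (A : pointedType) (I : choiceType).
Variables (nu : I -> probability (seqspace A) R) (w : I -> R).
Hypothesis countable_A : countable [set: A].
Hypothesis w_gt0 : forall i, 0 < w i.
Hypothesis sum_w : (\esum_(i in [set: I]) (w i)%:E = 1)%E.

Local Notation xi := (xi nu w).
Local Notation post := (post nu w).
Local Notation dKL := (dKL nu w).

Let w_ge0 i : 0 <= w i. Proof. exact/ltW. Qed.

Let wpr_ge0 i x : 0 <= w i * pr (nu i) x.
Proof. by rewrite mulr_ge0// pr_ge0. Qed.

Lemma weight_le1 i : w i <= 1.
Proof. by rewrite -lee_fin -sum_w (le_esum_term (fun i => (w i)%:E)). Qed.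

Lemma EFin_xi x :
  (xi x)%:E = (\esum_(i in [set: I]) (w i * pr (nu i) x)%:E)%E.
Proof.
rewrite /Defs.xi fineK// ge0_fin_numE; last first.
  by apply: esum_ge0 => i _; rewrite lee_fin.
apply: (@le_lt_trans _ _ 1%E); last by rewrite ltry.
by rewrite -sum_w; apply: le_esum => i _; rewrite lee_fin ler_piMr// pr_le1.
Qed.

Lemma le_xi i x : w i * pr (nu i) x <= xi x.
Proof.
by rewrite -lee_fin EFin_xi (le_esum_term (fun i => (w i * pr (nu i) x)%:E)).
Qed.

Lemma xi_ge0 x : 0 <= xi x.
Proof. by apply/fine_ge0/esum_ge0 => i _; rewrite lee_fin. Qed.

Lemma xi_gt0 i x : 0 < pr (nu i) x -> 0 < xi x.
Proof. by move=> p_gt0; apply: lt_le_trans (le_xi i x); rewrite mulr_gt0. Qed.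

Lemma xi_nil : xi [::] = 1.
Proof.
apply: EFin_inj; rewrite EFin_xi -sum_w.
by apply: eq_esum => i _; rewrite pr_nil mulr1.
Qed.

Lemma esum_xi_rcons x :
  (\esum_(a in [set: A]) (xi (rcons x a))%:E = (xi x)%:E)%E.
Proof.
under eq_esum do rewrite EFin_xi.
rewrite exchange_esum; last by move=> a i; rewrite lee_fin.
rewrite EFin_xi; apply: eq_esum => i _; under eq_esum do rewrite EFinM.
by rewrite esumZl ?esum_pr_rcons// => a; rewrite lee_fin pr_ge0.
Qed.

Lemma post_ge0 i x : 0 <= post i x.
Proof. by rewrite divr_ge0// xi_ge0. Qed.

Lemma post_le1 i x : post i x <= 1.
Proof.
have [xi0|xiN0] := eqVneq (xi x) 0; first by rewrite /Defs.post xi0 invr0 mulr0.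
by rewrite ler_pdivrMr ?mul1r ?le_xi// lt0r xiN0 xi_ge0.
Qed.

Lemma post_nil i : post i [::] = w i.
Proof. by rewrite /Defs.post xi_nil pr_nil divr1 mulr1. Qed.

Lemma xi_post i x : xi x * post i x = w i * pr (nu i) x.
Proof.
rewrite /Defs.post; have [xi0|xiN0] := eqVneq (xi x) 0; last first.
  by rewrite mulrC divfK.
by rewrite xi0 mul0r; apply/eqP; rewrite eq_le wpr_ge0 -xi0 le_xi.
Qed.

Lemma post_rcons i x a : 0 < pr (nu i) x ->
  post i (rcons x a) = post i x * (nu_cond nu i x a / xi_cond nu w x a).
Proof.
move=> p_gt0; have xi_gt0 := xi_gt0 p_gt0.
rewrite /Defs.post /nu_cond /xi_cond.
have [->|xiaN0] := eqVneq (xi (rcons x a)) 0.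
  by rewrite mul0r !invr0 !mulr0.
by field; rewrite xiaN0 !gt_eqF.
Qed.

Definition surprisal i x : R := - ln (post i x).

Lemma surprisal_ge0 i x : 0 <= surprisal i x.
Proof. by rewrite oppr_ge0 ln_le0// post_le1. Qed.

Lemma nu_cond_ge0 i x a : 0 <= nu_cond nu i x a.
Proof. by rewrite divr_ge0 ?pr_ge0. Qed.

Lemma esum_nu_cond i x : 0 < pr (nu i) x ->
  (\esum_(a in [set: A]) (nu_cond nu i x a)%:E = 1)%E.
Proof.
move=> p_gt0; apply: esum_normalized => // [a|]; first exact: pr_ge0.
exact: esum_pr_rcons.
Qed.

Lemma esum_xi_cond x : 0 < xi x ->
  (\esum_(a in [set: A]) (xi_cond nu w x a)%:E = 1)%E.
Proof.
move=> xi_gt0; apply: esum_normalized => // [a|]; first exact: xi_ge0.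
exact: esum_xi_rcons.
Qed.

Lemma post_gt0 i x : 0 < pr (nu i) x -> 0 < post i x.
Proof. by move=> p_gt0; rewrite divr_gt0 ?mulr_gt0// (xi_gt0 p_gt0). Qed.

Lemma post_nu_cond_le i x a : 0 < pr (nu i) x ->
  post i x * nu_cond nu i x a <= xi_cond nu w x a.
Proof.
move=> p_gt0; have xi_gt0 := xi_gt0 p_gt0.
rewrite [leLHS](_ : _ = w i * pr (nu i) (rcons x a) / xi x); last first.
  by rewrite /Defs.post /nu_cond; field; rewrite !gt_eqF.
by rewrite ler_pM2r ?invr_gt0// le_xi.
Qed.

Local Open Scope ereal_scope.

Lemma mixture_component_cond i x : (0 < pr (nu i) x)%R ->
  mixture_component (post i x) (nu_cond nu i x) (xi_cond nu w x).
Proof.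
move=> p_gt0; split.
- exact: post_gt0.
- exact: nu_cond_ge0.
- exact: esum_nu_cond.
- by rewrite esum_xi_cond// (xi_gt0 p_gt0).
- by move=> a; exact: post_nu_cond_le.
Qed.

Lemma dKL_ge0 i x : 0 <= dKL i x.
Proof.
have := pr_ge0 (nu i) x; rewrite le_eqVlt => /predU1P[p0|p_gt0].
  rewrite -[leRHS]/(relative_entropy _ _) (_ : nu_cond nu i x = fun=> 0%R).
    by rewrite relative_entropy0.
  by apply/funext => a; rewrite /nu_cond -p0 invr0 mulr0.
exact: relative_entropy_ge0 (mixture_component_cond p_gt0).
Qed.

Lemma dKLD_surprisal i x : (0 < pr (nu i) x)%R ->
  dKL i x +
  \esum_(a in [set: A]) (nu_cond nu i x a * surprisal i (rcons x a))%:E =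
  (surprisal i x)%:E.
Proof.
move=> p_gt0; rewrite -(relative_entropyD (mixture_component_cond p_gt0)).
by congr (_ + _); apply: eq_esum => a _; rewrite -post_rcons.
Qed.

Lemma pr_dKLD_surprisal i x :
  (pr (nu i) x)%:E * dKL i x +
  \esum_(a in [set: A]) (pr (nu i) (rcons x a) * surprisal i (rcons x a))%:E =
  (pr (nu i) x * surprisal i x)%:E.
Proof.
have := pr_ge0 (nu i) x; rewrite le_eqVlt => /predU1P[p0|p_gt0].
  rewrite -p0 mul0e mul0r esum1 ?adde0// => a _.
  suff -> : pr (nu i) (rcons x a) = 0%R by rewrite mul0r.
  by apply/eqP; rewrite eq_le pr_ge0 [in X in (_ <= X)%R]p0 pr_rcons_le.
have nu_surprisal_ge0 a : 0 <= (nu_cond nu i x a * surprisal i (rcons x a))%:E.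
  by rewrite lee_fin mulr_ge0 ?nu_cond_ge0 ?surprisal_ge0.
rewrite EFinM -dKLD_surprisal// [RHS]ge0_muleDr ?dKL_ge0 ?esum_ge0//.
rewrite -esumZl ?pr_ge0//.
congr (_ + _); apply: eq_esum => a _.
by rewrite -EFinM mulrA /nu_cond (mulrC (pr _ x)) divfK ?gt_eqF.
Qed.

Lemma integral_dKLD_surprisal i n :
  \int[nu i]_om dKL i (mkseq om n) +
  \int[nu i]_om (surprisal i (mkseq om n.+1))%:E =
  \int[nu i]_om (surprisal i (mkseq om n))%:E.
Proof.
pose s x := (surprisal i x)%:E.
have s_ge0 x : 0 <= s x by rewrite lee_fin surprisal_ge0.
rewrite (integral_prefix countable_A _ _ (@dKL_ge0 i)).
rewrite (integral_prefixS countable_A _ _ s_ge0).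
rewrite (integral_prefix countable_A _ _ s_ge0) -esumD.
- by apply: eq_esum => x _; rewrite -EFinM -pr_dKLD_surprisal.
- by move=> x _; rewrite mule_ge0 ?dKL_ge0// lee_fin pr_ge0.
- by move=> x _; apply: esum_ge0 => a _; rewrite mule_ge0// lee_fin pr_ge0.
Qed.

Lemma sum_integral_dKLD_surprisal i n :
  \sum_(0 <= k < n) \int[nu i]_om dKL i (mkseq om k) +
  \int[nu i]_om (surprisal i (mkseq om n))%:E = (- ln (w i))%:E.
Proof.
elim: n => [|n <-].
  rewrite big_nil add0e (integral_cst _ measurableT (surprisal i [::])%:E).
  by rewrite [X in _ * X]probability_setT mule1 /surprisal post_nil.
by rewrite big_nat_recr//= -addeA integral_dKLD_surprisal.
Qed.

Lemma nneseries_integral_dKL_le i :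
  \sum_(n <oo) \int[nu i]_om dKL i (mkseq om n) <= (- ln (w i))%:E.
Proof.
apply: lime_le.
  apply: is_cvg_nneseries => n _ _.
  by apply: integral_ge0 => om _; exact: dKL_ge0.
near=> n; rewrite -(sum_integral_dKLD_surprisal i n) leeDl// integral_ge0//.
by move=> om _; rewrite lee_fin surprisal_ge0.
Unshelve. all: by end_near. Qed.

Definition posterior_divergence (x : seq A) : \bar R :=
  xsum (fun i => (post i x)%:E * dKL i x).

Let post_dKL_ge0 i x : 0 <= (post i x)%:E * dKL i x.
Proof. by rewrite mule_ge0 ?dKL_ge0// lee_fin post_ge0. Qed.

Lemma posterior_divergenceE x :
  posterior_divergence x = \esum_(i in [set: I]) (post i x)%:E * dKL i x.
Proof. by rewrite /posterior_divergence ge0_xsumE. Qed.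

Lemma posterior_divergence_ge0 x : 0 <= posterior_divergence x.
Proof. by rewrite posterior_divergenceE esum_ge0. Qed.

Lemma xi_posterior_divergence x :
  (xi x)%:E * posterior_divergence x =
  \esum_(i in [set: I]) (w i)%:E * ((pr (nu i) x)%:E * dKL i x).
Proof.
rewrite posterior_divergenceE -esumZl ?xi_ge0//.
by apply: eq_esum => i _; rewrite !muleA -!EFinM xi_post.
Qed.

Lemma esum_xi_posterior_divergence n :
  \esum_(x in words n) (xi x)%:E * posterior_divergence x =
  \esum_(i in [set: I]) (w i)%:E * \int[nu i]_om dKL i (mkseq om n).
Proof.
have pr_dKL_ge0 i x : 0 <= (pr (nu i) x)%:E * dKL i x.
  by rewrite mule_ge0 ?dKL_ge0// lee_fin pr_ge0.
under eq_esum do rewrite xi_posterior_divergence.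
rewrite exchange_esum; last by move=> x i; rewrite mule_ge0 ?lee_fin.
apply: eq_esum => i _; rewrite esumZl//.
by rewrite integral_prefix//; exact: dKL_ge0.
Qed.

Lemma integral_posterior_divergence_le i n :
  (w i)%:E * \int[nu i]_om posterior_divergence (mkseq om n) <=
  \esum_(j in [set: I]) (w j)%:E * \int[nu j]_om dKL j (mkseq om n).
Proof.
have D_ge0 := posterior_divergence_ge0.
rewrite -esum_xi_posterior_divergence integral_prefix// -esumZl//; last first.
  by move=> x; rewrite mule_ge0// lee_fin pr_ge0.
apply: le_esum => x _; rewrite muleA lee_wpmul2r//.
by rewrite -EFinM lee_fin le_xi.
Qed.

Lemma EntE : Ent w = \esum_(i in [set: I]) (w i)%:E * (- ln (w i))%:E.
Proof.
have wlnE i : (- (w i * ln (w i)))%:E = (w i)%:E * (- ln (w i))%:E.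
  by rewrite -EFinM mulrN.
rewrite /Ent ge0_xsumE => [|i]; first by apply: eq_esum.
by rewrite wlnE mule_ge0 ?lee_fin// oppr_ge0 ln_le0// weight_le1.
Qed.

Lemma nneseries_integral_posterior_divergence_le i :
  (w i)%:E * \sum_(n <oo) \int[nu i]_om posterior_divergence (mkseq om n) <=
  Ent w.
Proof.
have D_ge0 j n : 0 <= \int[nu j]_om dKL j (mkseq om n).
  by apply: integral_ge0 => om _; exact: dKL_ge0.
have pD_ge0 n : 0 <= \int[nu i]_om posterior_divergence (mkseq om n).
  by apply: integral_ge0 => om _; exact: posterior_divergence_ge0.
have wD_ge0 j n : 0 <= (w j)%:E * \int[nu j]_om dKL j (mkseq om n).
  by rewrite mule_ge0 ?lee_fin.
rewrite -nneseriesZl; last by [].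
apply: (@le_trans _ _ (\sum_(n <oo)
    \esum_(j in [set: I]) (w j)%:E * \int[nu j]_om dKL j (mkseq om n))).
  apply: lee_nneseries => n *; last exact: integral_posterior_divergence_le.
  by rewrite mule_ge0 ?lee_fin.
rewrite nneseries_esumT; last by move=> n; exact: esum_ge0.
rewrite exchange_esum// EntE; apply: le_esum => j _.
rewrite esumZl// lee_wpmul2l ?lee_fin// -nneseries_esumT//.
exact: nneseries_integral_dKL_le.
Qed.

Lemma ct_ge0 t om : 0 <= ct nu w t om.
Proof. exact: posterior_divergence_ge0. Qed.

Lemma series_ctE om :
  \sum_(1 <= t <oo) ct nu w t om =
  \sum_(n <oo) posterior_divergence (mkseq om n).
Proof.
rewrite -[LHS](@nneseries_addn _ (ct nu w ^~ om) 1); last first.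
  by move=> t; exact: ct_ge0.
by apply: eq_eseriesr => n _; rewrite addn1.
Qed.

Lemma measurable_series_ct :
  measurable_fun [set: seqspace A] (fun om => \sum_(1 <= t <oo) ct nu w t om).
Proof.
rewrite (funext series_ctE).
apply: (ge0_emeasurable_sum (P := predT)) => [n om _ _|n _].
  exact: posterior_divergence_ge0.
exact: measurable_fun_prefix.
Qed.

Lemma series_ct_ge0 om : 0 <= \sum_(1 <= t <oo) ct nu w t om.
Proof. by apply: nneseries_ge0 => t _ _; exact: ct_ge0. Qed.

Lemma integral_series_ct_le i :
  \int[nu i]_om (\sum_(1 <= t <oo) ct nu w t om) <= Ent w * (w i)^-1%:E.
Proof.
rewrite muleC lee_pdivlMl//; under eq_integral do rewrite series_ctE.
rewrite integral_nneseries//.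
- exact: nneseries_integral_posterior_divergence_le.
- by move=> n; exact: measurable_fun_prefix.
- by move=> n om _; exact: posterior_divergence_ge0.
Qed.

End mixture.

Theorem theorem7 (R : realType) (A : pointedType) (I : choiceType)
  (nu : I -> probability (seqspace A) R) (w : I -> R) (mu : I) (delta : R) :
  countable [set: A] ->
  countable [set: I] ->
  injective nu ->
  (forall i, 0 < w i <= 1) ->
  (\esum_(i in [set: I]) (w i)%:E = 1)%E ->
  0 < delta < 1 ->
  let dhat := fun (t : nat) (om : nat -> A) =>
    (ct nu w t om * ((w mu * delta)^-1)%:E)%E in
  (\int[nu mu]_om (\sum_(1 <= t <oo) dhat t om)
     <= Ent w * ((delta * w mu ^+ 2)^-1)%:E)%E /\
  (exists E : set (seqspace A), measurable E /\
     (nu mu E >= (1 - delta)%:E)%E /\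
     forall om, E om ->
       (\sum_(1 <= t <oo) dhat t om <= Ent w * ((delta ^+ 2 * w mu ^+ 2)^-1)%:E)%E).
Proof.
move=> countable_A _ _ w01 sum_w /andP[delta_gt0 _] dhat.
have w_gt0 i : 0 < w i by have /andP[] := w01 i.
pose S (om : seqspace A) := (\sum_(1 <= t <oo) ct nu w t om)%E.
have S_ge0 om : (0 <= S om)%E by exact: series_ct_ge0.
have mS : measurable_fun setT S by exact: measurable_series_ct.
have intS := integral_series_ct_le nu countable_A w_gt0 sum_w mu.
have wdV_ge0 : 0 <= (w mu * delta)^-1 by rewrite invr_ge0 mulr_ge0// ltW.
have dhatE om : (\sum_(1 <= t <oo) dhat t om = ((w mu * delta)^-1)%:E * S om)%E.
  rewrite -nneseriesZl; last by move=> t _; exact: ct_ge0.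
  by apply: eq_eseriesr => t _; rewrite muleC.
split.
  under eq_integral do rewrite dhatE.
  rewrite ge0_integralZl//; apply: le_trans (lee_wpmul2l _ intS) _ => //.
  rewrite muleCA -EFinM (_ : _ / _ = (delta * w mu ^+ 2)^-1)//.
  by field; rewrite !gt_eqF.
exists [set om | S om <= Ent w * (w mu)^-1%:E * delta^-1%:E]%E.
split.
  by rewrite -[X in measurable X]setTI; exact: emeasurable_fun_infty_c.
split=> [|om /= S_le]; first exact: markov_probability_le.
rewrite dhatE; apply: le_trans (lee_wpmul2l _ S_le) _ => //.
rewrite -muleA -EFinM muleCA -EFinM (_ : _ * _ = (delta ^+ 2 * w mu ^+ 2)^-1)//.
by field; rewrite !gt_eqF.
Qed.
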